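(* For each of the following nondecreasing functions $f$ on $\mathbb{N}$, there exists a finitely generated LEF group $\Gamma$ such that $\mathcal{L}_{\Gamma} \approx f$: (i) $f(n) = \exp(\exp(n))$; (ii) $f(n) = \exp(n^k)$, for each $k \in \mathbb{N}$; (iii) $f(n) = n^k$, for each $k \in \mathbb{N}$.
   Context: $\mathbb{N}=\{1,2,\ldots\}$. For groups $\Gamma,\Delta$ and $F\subseteq\Gamma$, a local embedding of $F$ into $\Delta$ is an injective function $\pi:F\to\Delta$ such that for all $g,h\in F$, if $gh\in F$ then $\pi(gh)=\pi(g)\pi(h)$. $\Gamma$ is LEF (locally embeddable into finite groups) if every finite subset of $\Gamma$ admits a local embedding into some finite group. For a group $\Gamma$ generated by a finite set $S$, let $B_S(n)$ be the closed ball of radius $n$ around the identity in the word metric of $S$. LEF growth: $\mathcal{L}_\Gamma^S(n)=\min\{|Q| : Q$ a finite group for which there is a local embedding $B_S(n)\to Q\}$. Comparison: for functions $f_1,f_2$ from $\mathbb{N}$ to $(0,\infty)$, $f_1\preceq f_2$ means that there is a constant $C>0$ with $f_1(n)\le f_2(Cn)$ for all $n\in\mathbb{N}$, where functions on $\mathbb{N}$ are evaluated at real $x>0$ by $f(x)=f(\lceil x\rceil)$; $f_1\approx f_2$ means $f_1\preceq f_2$ and $f_2\preceq f_1$. Up to $\approx$, $\mathcal{L}_\Gamma^S$ does not depend on the finite generating set $S$, and one writes $\mathcal{L}_\Gamma$. *)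

(* Defs.v *)
From mathcomp Require Import all_boot all_order all_algebra all_fingroup.
From mathcomp Require Import all_classical all_reals all_analysis.

Set Implicit Arguments.
Unset Strict Implicit.
Unset Printing Implicit Defensive.

Import Order.TTheory GRing.Theory Num.Theory.

Local Open Scope classical_set_scope.
Local Open Scope ring_scope.

(* A map F -> D is represented by a total function of which only the values on
   F matter; this loses nothing since D is nonempty. *)
Definition local_embedding (G D : groupType) (F : set G) (pi : G -> D) : Prop :=
  (forall g h, F g -> F h -> pi g = pi h -> g = h) /\
  (forall g h, F g -> F h -> F (g * h)%g -> pi (g * h)%g = (pi g * pi h)%g).

Definition LEF (G : groupType) : Prop :=
  forall F : set G, finite_set F ->
    exists (Q : finGroupType) (pi : G -> Q), local_embedding F pi.

(* The closed ball of radius n around 1 in the word metric of S: the products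
   of at most n letters taken from S and the inverses of its elements. *)
Definition word_ball (G : groupType) (S : set G) (n : nat) : set G :=
  [set g | exists w : seq G, [/\ (size w <= n)%N,
     (forall x, x \in w -> S x \/ S (x^-1)%g) & g = (\prod_(x <- w) x)%g]].

Definition generates (G : groupType) (S : set G) : Prop :=
  forall g : G, exists n, word_ball S n g.

Definition finitely_generated (G : groupType) : Prop :=
  exists S : set G, finite_set S /\ generates S.

Definition LEF_orders (G : groupType) (S : set G) (n : nat) : set nat :=
  [set m | exists Q : finGroupType,
     #|Q| = m /\ exists pi : G -> Q, local_embedding (word_ball S n) pi].

(* The minimum of LEF_orders S n; the default 0 is only returned when this set
   is empty, which does not happen for S finite and G LEF. *)
Definition LEF_growth (G : groupType) (S : set G) (n : nat) : nat :=
  xget 0%N [set m | LEF_orders S n m /\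
                    forall m', LEF_orders S n m' -> (m <= m')%N].

(* Functions on {1, 2, ...} are represented by functions on nat whose value at 0
   is never used; they are evaluated at a real x > 0 through the ceiling. *)
Definition eval_ceil (R : realType) (f : nat -> R) (x : R) : R :=
  f `|Num.ceil x|%N.

Definition growth_le (R : realType) (f1 f2 : nat -> R) : Prop :=
  exists C : R, 0 < C /\
    forall n : nat, (0 < n)%N -> f1 n <= eval_ceil f2 (C * n%:R).

Definition growth_equiv (R : realType) (f1 f2 : nat -> R) : Prop :=
  growth_le f1 f2 /\ growth_le f2 f1.

(* The growth of G is only defined up to growth_equiv, so the comparison is
   required for every finite generating set. *)
Definition has_LEF_growth (R : realType) (G : groupType) (f : nat -> R) : Prop :=
  forall S : set G, finite_set S -> generates S ->
    growth_equiv (fun n => (LEF_growth S n)%:R) f.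

(* Main.v *)
From HB Require Import structures.
Require Import Defs.
From mathcomp Require Import all_boot all_order all_algebra all_fingroup.
From mathcomp Require Import all_classical all_reals all_analysis.
From mathcomp Require Import zify.

Local Open Scope ring_scope.

(* The examples are Z^k, S_3 wr Z^k and S_3 wr (S_3 wr Z).

   Upper bounds: a local embedding of the ball of radius 2n of G into Q induces
   one of the ball of radius n of D wr G into D wr Q, by pushing configurations
   forward.

   Lower bounds: Z^k has more than n^k elements in its ball of radius n.  In
   D wr G, the copies of D at the points of a ball of G commute pairwise, and
   a local embedding into Q preserves this.  Pairwise commuting copies of a
   centerless group D generate their direct product, because each of them meets
   the subgroup generated by the others in its own center; hence
   |Q| >= |D|^|ball|, although elements supported on many points of the ball lie
   far outside the domain of the local embedding.  The balls of S_3 wr Z grow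
   exponentially, which gives exp(exp n) for the iterated wreath product. *)

Set Implicit Arguments.
Unset Strict Implicit.
Unset Printing Implicit Defensive.
Import Order.TTheory GRing.Theory Num.Theory.

(** * Wreath products, and their finiteness over finite groups *)

Definition mulg_of (V : zmodType) : Type := V.
HB.instance Definition _ (V : zmodType) := Choice.on (mulg_of V).
HB.instance Definition _ (V : zmodType) :=
  isGroup.Build (mulg_of V) (@addrA V) (@add0r V) (@addr0 V) (@addNr V) (@addrN V).

(* The unrestricted wreath product: finite generation is recovered by passing to
   the subgroup spanned by [wreath_gens] below. *)
Definition wreath (D G : groupType) : Type := ((G -> D) * G)%type.

Section Wreath.
Variables D G : groupType.
HB.instance Definition _ := Choice.copy (wreath D G) ((G -> D) * G)%type.
Implicit Types u v w : wreath D G.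

Definition wreath_one : wreath D G := (fun=> 1%g, 1%g).
(** Semidirect product for the left translation action of [G] on configurations: [u.1] is the state
    of the lamps, [u.2] the position of the lamplighter. *)
Definition wreath_mul u v : wreath D G :=
  (fun x => (u.1 x * v.1 (u.2^-1 * x))%g, (u.2 * v.2)%g).
Definition wreath_inv u : wreath D G := (fun x => ((u.1 (u.2 * x))^-1)%g, (u.2^-1)%g).

Fact wreath_mulA : associative wreath_mul.
Proof.
move=> u v w; congr (_, _) => /=; last exact: mulgA.
by apply/funext => x; rewrite /= invgM !mulgA.
Qed.
Fact wreath_mul1u : left_id wreath_one wreath_mul.
Proof.
case=> f g; congr (_, _) => /=; last exact: mul1g.
by apply/funext => x; rewrite /= mul1g invg1 mul1g.
Qed.
Fact wreath_mulu1 : right_id wreath_one wreath_mul.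
Proof.
case=> f g; congr (_, _) => /=; last exact: mulg1.
by apply/funext => x; rewrite /= mulg1.
Qed.
Fact wreath_mulV : left_inverse wreath_one wreath_inv wreath_mul.
Proof.
case=> f g; congr (_, _) => /=; last exact: mulVg.
by apply/funext => x; rewrite /= invgK mulVg.
Qed.
Fact wreath_mulVr : right_inverse wreath_one wreath_inv wreath_mul.
Proof.
case=> f g; congr (_, _) => /=; last exact: mulgV.
by apply/funext => x; rewrite /= mulgA mulgV mul1g mulgV.
Qed.
HB.instance Definition _ := isGroup.Build (wreath D G)
  wreath_mulA wreath_mul1u wreath_mulu1 wreath_mulV wreath_mulVr.
End Wreath.

Section FinWreath.
Variables D Q : finGroupType.
Definition wreath_enc (u : wreath D Q) : {ffun Q -> D} * Q := ([ffun x => u.1 x], u.2).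
Definition wreath_dec (u : {ffun Q -> D} * Q) : wreath D Q := (fun x => u.1 x, u.2).
Fact wreath_encK : cancel wreath_enc wreath_dec.
Proof. by case=> f q; congr (_, _); apply/funext => x; rewrite /= ffunE. Qed.
Fact wreath_decK : cancel wreath_dec wreath_enc.
Proof. by case=> f q; congr (_, _); apply/ffunP => x; rewrite ffunE. Qed.
HB.instance Definition _ := CanIsCountable wreath_encK.
Fact wreath_enumP : Finite.axiom (map wreath_dec (enum {: {ffun Q -> D} * Q})).
Proof.
apply: Finite.uniq_enumP => [|u].
  by rewrite map_inj_uniq ?enum_uniq //; exact: can_inj wreath_decK.
by rewrite -[u]wreath_encK map_f ?mem_enum.
Qed.
HB.instance Definition _ := fintype.isFinite.Build (wreath D Q) wreath_enumP.

Lemma card_wreath : #|(wreath D Q : finGroupType)| = (#|D| ^ #|Q| * #|Q|)%N.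
Proof.
rewrite -card_ffun -card_prod.
exact: bij_eq_card (Bijective wreath_encK wreath_decK).
Qed.
End FinWreath.

(** * Word balls and change of generators *)

Section WordBall.
Variables (H : groupType) (S : set H).

Lemma word_ball0 : word_ball S 0 1%g.
Proof. by exists [::]; split => //; rewrite big_nil. Qed.

Lemma word_ball_mono m n g : (m <= n)%N -> word_ball S m g -> word_ball S n g.
Proof. by move=> mn [w [sz Sw ->]]; exists w; split=> //; exact: leq_trans mn. Qed.

Lemma word_ball1 n : word_ball S n 1%g.
Proof. exact: word_ball_mono word_ball0. Qed.

Lemma word_ball_gen g : S g -> word_ball S 1 g.
Proof.
move=> Sg; exists [:: g]; split=> //; last by rewrite big_seq1.
by move=> x; rewrite inE => /eqP ->; left.
Qed.

Lemma word_ballM m n g h :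
  word_ball S m g -> word_ball S n h -> word_ball S (m + n) (g * h)%g.
Proof.
move=> [v [sv Sv ->]] [w [sw Sw ->]]; exists (v ++ w); split.
- by rewrite size_cat leq_add.
- by move=> x; rewrite mem_cat => /orP[/Sv|/Sw].
- by rewrite big_cat.
Qed.

Lemma word_ballV n g : word_ball S n g -> word_ball S n g^-1%g.
Proof.
move=> [w [sw Sw ->]]; exists (rev (map (fun x => x^-1)%g w)); split.
- by rewrite size_rev size_map.
- move=> x; rewrite mem_rev => /mapP[y /Sw Sy ->].
  by rewrite invgK; case: Sy; [right|left].
- rewrite -map_rev big_map; elim: w {sw Sw} => [|x w IH].
    by rewrite !big_nil invg1.
  by rewrite big_cons rev_cons big_rcons invgM IH.
Qed.

Lemma word_ball_prod n m (I : Type) (r : seq I) (F : I -> H) :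
  (forall i, word_ball S m (F i)) -> (size r <= n)%N ->
  word_ball S (n * m) (\prod_(i <- r) F i)%g.
Proof.
move=> BF; elim: r n => [|i r IH] [|n]//= sz; rewrite ?big_nil ?big_cons;
  try exact: word_ball1.
by rewrite mulSn; apply: word_ballM => //; exact: IH.
Qed.

End WordBall.

(** Substituting a word of length at most [c] for each letter multiplies lengths by at most [c];
    this is why the growth type does not depend on the generating set. *)
Lemma word_ball_sub (H : groupType) (S T : set H) c :
  (forall x, T x -> word_ball S c x) ->
  forall n g, word_ball T n g -> word_ball S (c * n) g.
Proof.
move=> TS n g [w [sw Tw ->]]; rewrite mulnC.
elim: w n sw Tw => [|x w IH] [|n]//= sw Tw; rewrite ?big_nil ?big_cons;
  try exact: word_ball1.
rewrite mulSn; apply: word_ballM.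
  have [/TS//|/TS/word_ballV] := Tw x (mem_head _ _).
  by rewrite invgK.
by apply: IH => // y yw; apply: Tw; rewrite inE yw orbT.
Qed.

(** Serves both to compare two finite generating sets and to place an arbitrary finite set inside a
    ball. *)
Lemma finite_generated_bounded (H : groupType) (S T : set H) :
  finite_set T -> generates S -> exists c, forall x, T x -> word_ball S c x.
Proof.
move=> /finite_seqP[s ->] gS; elim: s => [|x s [c IH]]; first by exists 0%N.
have [d xd] := gS x; exists (c + d)%N => y /=; rewrite inE => /orP[/eqP->|ys].
  exact: word_ball_mono (leq_addl _ _) xd.
exact: word_ball_mono (leq_addr _ _) (IH _ ys).
Qed.

(** * Restriction of local embeddings; the minimal order *)

Lemma local_embedding_sub (G D : groupType) (E F : set G) (pi : G -> D) :
  (E `<=` F)%classic -> local_embedding F pi -> local_embedding E pi.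
Proof. by move=> EF [inj mor]; split=> [g h|g h] *; [apply: inj|apply: mor]; auto. Qed.

(** By well-ordering, the minimum is attained as soon as one order occurs, so the default value of
    [xget] does not arise. *)
Lemma LEF_growth_le (G : groupType) (S : set G) n m :
  LEF_orders S n m -> LEF_orders S n (LEF_growth S n) /\ (LEF_growth S n <= m)%N.
Proof.
move=> Lm; rewrite /LEF_growth.
suff [k Pk] : exists k, LEF_orders S n k /\
    forall m', LEF_orders S n m' -> (k <= m')%N.
  by case: xgetP => [l _ [L lmin]|/(_ k)//]; split=> //; exact: lmin.
have ex : exists k, `[< LEF_orders S n k >] by exists m; apply/asboolP.
case: (ex_minnP ex) => k /asboolP Lk kmin; exists k; split=> // m' /asboolP.
exact: kmin.
Qed.

(** * The subgroup spanned by a set, as a group of its own *)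

Section GeneratedSubgroup.
Variables (H : groupType) (S : set H).

Definition span_pred : {pred H} := fun g => `[< exists n, word_ball S n g >].

Record span_of := Span { span_val : H; _ : span_val \in span_pred }.
HB.instance Definition _ := [isSub for span_val].
HB.instance Definition _ := [Choice of span_of by <:].

Fact span_group_closed : group_closed span_pred.
Proof.
split; first by apply/asboolP; exists 0%N; exact: word_ball0.
move=> x y /asboolP[m xm] /asboolP[n yn]; apply/asboolP.
by exists (m + n)%N; apply: word_ballM => //; exact: word_ballV.
Qed.
HB.instance Definition _ := SubChoice_isSubGroup.Build H span_pred span_of span_group_closed.

Definition span_gens : set span_of := [set g | S (val g)].

(** All letters of a word in [S] lie in the span, so balls of the span can be computed in the
    ambient group. *)
Lemma word_ball_span n (g : span_of) :
  word_ball span_gens n g <-> word_ball S n (val g).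
Proof.
split=> [[w [sw Sw ->]]|[w [sw Sw gE]]].
  exists (map val w); split; first by rewrite size_map.
  - move=> _ /mapP[x /Sw xS ->]; case: xS; rewrite /span_gens /= => ?; [by left|right].
    by rewrite -(gmulfV (val : span_of -> H)).
  - rewrite big_map; elim: w {sw Sw} => [|x w IH]; rewrite ?big_nil ?big_cons ?gmulf1//.
    by rewrite gmulfM; congr (_ * _)%g.
have wS x : x \in w -> x \in span_pred.
  move=> /Sw xS; apply/asboolP; exists 1%N; case: xS => [|/word_ball_gen/word_ballV].
    exact: word_ball_gen.
  by rewrite invgK.
(* By [wS] every letter lies in the span, so [pmap insub] drops none of them. *)
exists (pmap insub w); split.
- by rewrite size_pmap (leq_trans (count_size _ _)).
- by move=> x; rewrite mem_pmap_sub => /Sw [Sx|SVx]; [left|right].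
- apply: (@val_inj _ _ span_of); rewrite gE; elim: w wS {sw Sw gE} => [|x w IH] wS.
    by rewrite !big_nil val1.
  have px := wS x (mem_head _ _).
  have -> : pmap insub (x :: w) = Sub x px :: pmap insub w :> seq span_of.
    by rewrite /= insubT.
  rewrite !big_cons valM; congr (_ * _)%g; apply: IH => y yw.
  by apply: wS; rewrite inE yw orbT.
Qed.

Lemma span_generates : generates span_gens.
Proof.
by move=> g; have /asboolP[n gn] := valP g; exists n; apply/word_ball_span.
Qed.

Lemma span_gens_finite : finite_set S -> finite_set span_gens.
Proof. by move=> fS; apply: finite_preimage => // x y _ _; exact: val_inj. Qed.

End GeneratedSubgroup.
Arguments span_gens {H} S _.

(** * A criterion for a given growth type *)

Lemma eval_ceilM (R : realType) (f : nat -> R) (a n : nat) :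
  eval_ceil f (a%:R * n%:R) = f (a * n)%N.
Proof. by rewrite /eval_ceil -natrM pmulrn intrKceil. Qed.

(** Lets lower bounds be proved in the ambient group. [insubd] sends elements outside the span to 1,
    which is harmless since the ball lies in the span. *)
Lemma local_embedding_span (H Q : groupType) (S : set H) n (pi : span_of S -> Q) :
  local_embedding (word_ball (span_gens S) n) pi ->
  local_embedding (word_ball S n) (fun h => pi (insubd 1%g h)).
Proof.
have lift g : word_ball S n g -> exists2 g', g = val g' & word_ball (span_gens S) n g'.
  move=> Bg; have pg : g \in span_pred S by apply/asboolP; exists n.
  by exists (Sub g pg); rewrite ?SubK //; apply/word_ball_span; rewrite SubK.
move=> [inj mor]; split.
  move=> _ _ /lift[g -> Bg] /lift[h -> Bh].
  by rewrite !valKd => /inj ->.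
move=> _ _ /lift[g -> Bg] /lift[h -> Bh].
by rewrite -valM => /word_ball_span Bgh; rewrite !valKd; exact: mor.
Qed.

(** Reduces each example to two estimates for a single finite set [S] in an ambient group. The
    factors [a] and [b], and the cost of passing to another generating set, are absorbed in the
    constant of [growth_le]; it is chosen in the natural numbers, where the ceiling is exact. *)
Lemma exists_group_of_growth (R : realType) (f : nat -> R)
    (H : groupType) (S : set H) (a b : nat) :
  finite_set S -> {homo f : m n / (m <= n)%N >-> m <= n} ->
  (forall n, (0 < n)%N -> exists (Q : finGroupType) (pi : H -> Q),
     local_embedding (word_ball S n) pi /\ #|Q|%:R <= f (a * n)%N) ->
  (forall n (Q : finGroupType) (pi : H -> Q), (0 < n)%N ->
     local_embedding (word_ball S (b * n)) pi -> f n <= #|Q|%:R) ->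
  exists G : groupType, finitely_generated G /\ LEF G /\ has_LEF_growth G f.
Proof.
move=> finS fmono upper lower; exists (span_of S).
have upper' n : (0 < n)%N -> exists (Q : finGroupType) (pi : span_of S -> Q),
    local_embedding (word_ball (span_gens S) n) pi /\ #|Q|%:R <= f (a * n)%N.
  move=> /upper[Q [pi [[inj mor] le]]]; exists Q, (fun g => pi (val g)); split=> //.
  split=> [g h /word_ball_span Bg /word_ball_span Bh|].
    by move=> /(inj _ _ Bg Bh)/val_inj.
  move=> g h /word_ball_span Bg /word_ball_span Bh /word_ball_span.
  by rewrite valM => Bgh; exact: mor.
have gS := @span_generates _ S.
split; first by exists (span_gens S); split=> //; exact: span_gens_finite.
split.
  move=> F /finite_generated_bounded-/(_ _ gS)[c Fc].
  (* The upper estimate is available for positive radii only, hence [c.+1]. *)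
  have [Q [pi [emb _]]] := upper' c.+1 isT; exists Q, pi.
  apply: local_embedding_sub emb => g /Fc; exact: word_ball_mono.
move=> U finU gU.
have [c Uc] := finite_generated_bounded finU gS.
have [d Sd] := finite_generated_bounded (span_gens_finite finS) gU.
have Uball := word_ball_sub Uc; have Sball := word_ball_sub Sd.
have orders n : (0 < n)%N -> exists2 m, LEF_orders U n m & m%:R <= f (a * (c.+1 * n))%N.
  move=> n0; have [|Q [pi [emb le]]] := upper' (c.+1 * n)%N; first by rewrite muln_gt0.
  exists #|Q| => //; exists Q; split=> //; exists pi; apply: local_embedding_sub emb.
  by move=> g /Uball; apply: word_ball_mono; rewrite leq_mul.
split.
  exists (a * c.+1).+1%:R; split=> [|n n0]; first by rewrite ltr0n.
  rewrite eval_ceilM; have [m mU mf] := orders _ n0.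
  have [_ le] := LEF_growth_le mU.
  rewrite (le_trans _ (le_trans mf _)) ?ler_nat//.
  by apply: fmono; rewrite mulnA leq_mul2r leqnSn orbT.
(* The [U]-ball of radius [d * (b * n)] contains the ball of radius [b * n] on which [lower] is
   stated; the successor keeps the constant positive. *)
exists (d * b).+1%:R; split=> [|n n0]; first by rewrite ltr0n.
rewrite eval_ceilM.
have n0' : (0 < (d * b).+1 * n)%N by rewrite muln_gt0.
have [m mU _] := orders _ n0'.
have [[Q [<- [pi emb]]] _] := LEF_growth_le mU.
apply: lower n0 (local_embedding_span (local_embedding_sub _ emb)).
by move=> g /Sball; apply: word_ball_mono; rewrite mulnA leq_mul2r leqnSn orbT.
Qed.

(** * Generators and balls of the wreath product *)

Section WreathGenerators.
Variables (D : finGroupType) (G : groupType).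
Implicit Types (x y : G) (d e : D).

Definition lamp x d : wreath D G := (fun y => if y == x then d else 1%g, 1%g).
Definition shift x : wreath D G := (fun=> 1%g, x).

Lemma wreathM1 (u v : wreath D G) x : (u * v)%g.1 x = (u.1 x * v.1 (u.2^-1 * x))%g.
Proof. by []. Qed.

Lemma wreathM2 (u v : wreath D G) : (u * v)%g.2 = (u.2 * v.2)%g.
Proof. by []. Qed.

Lemma shiftM x y : shift (x * y)%g = (shift x * shift y)%g.
Proof. by congr (_, _); apply/funext => z; rewrite mulg1. Qed.

Lemma shiftV x : shift x^-1%g = (shift x)^-1%g.
Proof. by apply: (@mulgI _ (shift x)); rewrite mulgV -shiftM mulgV. Qed.

Lemma lampM x d e : lamp x (d * e)%g = (lamp x d * lamp x e)%g.
Proof.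
congr (_, _); last by rewrite /= mulg1.
by apply/funext => y; rewrite /= invg1 mul1g; case: ifP; rewrite ?mulg1.
Qed.

Lemma lamp1 x : lamp x 1%g = 1%g.
Proof. by congr (_, _); apply/funext => y; case: ifP. Qed.

Lemma lampV x d : lamp x d^-1%g = (lamp x d)^-1%g.
Proof. by apply: (@mulgI _ (lamp x d)); rewrite mulgV -lampM mulgV lamp1. Qed.

Lemma lamp_inj x : injective (lamp x).
Proof. by move=> d e [/(congr1 (@^~ x))]; rewrite eqxx. Qed.

Lemma lamp_commute x y d e : x != y ->
  (lamp x d * lamp y e = lamp y e * lamp x d)%g.
Proof.
move=> xy; congr (_, _); apply/funext => z /=; rewrite !invg1 !mul1g.
by case: (z =P x) => [->|_]; rewrite ?(negbTE xy) ?mulg1 ?mul1g.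
Qed.

Lemma lamp_conj x d : lamp x d = (shift x * lamp 1 d * shift x^-1)%g.
Proof.
congr (_, _); last by rewrite /= mulg1 mulgV.
apply/funext => y /=; rewrite mul1g mulg1; congr (if _ then _ else _).
by rewrite -[RHS](inj_eq (@mulgI _ x)) mulKVg mulg1.
Qed.

Variable S : set G.

Definition wreath_gens : set (wreath D G) :=
  (range (lamp 1%g) `|` shift @` S)%classic.

Lemma wreath_gens_finite : finite_set S -> finite_set wreath_gens.
Proof.
move=> finS; rewrite finite_setU; split; last exact: finite_image.
exact/finite_image/finite_finset.
Qed.

Lemma shift_ball n x : word_ball S n x -> word_ball wreath_gens n (shift x).
Proof.
move=> [w [sw Sw ->]]; exists (map shift w); split; first by rewrite size_map.
  move=> _ /mapP[y /Sw yS ->]; case: yS => yS; [left|right]; right.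
    by exists y.
  by rewrite -shiftV; eexists; [exact: yS|].
rewrite big_map; elim: w {sw Sw} => [|y w IH]; rewrite ?big_nil ?big_cons //.
by rewrite shiftM IH.
Qed.

(** Walk to [x], switch the lamp there, walk back: n + 1 + n letters. *)
Lemma lamp_ball n x d :
  word_ball S n x -> word_ball wreath_gens (n.*2.+1) (lamp x d).
Proof.
move=> Bx; rewrite lamp_conj -addnn -addn1 addnAC.
apply: word_ballM; last by apply/shift_ball/word_ballV.
apply: word_ballM; first exact: shift_ball.
by apply: word_ball_gen; left; exists d.
Qed.

(** In n letters the lamplighter stays within radius n and lights lamps only at points that it
    visits. *)
Lemma wreath_ball n (u : wreath D G) : word_ball wreath_gens n u ->
  word_ball S n u.2 /\ forall x, u.1 x != 1%g -> word_ball S n x.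
Proof.
move=> [w [sw Sw ->]].
elim: w n sw Sw => [|t w IH] n sw Sw.
  by rewrite big_nil; split=> [|x]; [exact: word_ball1|rewrite /= eqxx].
case: n sw => // n sw; rewrite big_cons -add1n.
have [IH2 IH1] : word_ball S n (\prod_(x <- w) x)%g.2 /\
    forall x, (\prod_(x <- w) x)%g.1 x != 1%g -> word_ball S n x.
  by apply: IH => // y yw; apply: Sw; rewrite inE yw orbT.
have [t2 t1] : word_ball S 1 t.2 /\ forall x, t.1 x != 1%g -> word_ball S 0 x.
  have lampP d : word_ball S 1 (lamp 1 d).2 /\
      forall x, (lamp 1 d).1 x != 1%g -> word_ball S 0 x.
    split=> [|x]; first exact: word_ball1.
    by rewrite /=; case: (x =P 1%g) => [->|_]; rewrite ?eqxx // => _; exact: word_ball0.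
  have [|] := Sw t (mem_head _ _).
    move=> [[d _ <-]//|[s Ss <-]].
    by split=> [|x]; [exact: word_ball_gen|rewrite eqxx].
  move=> [[d _ /(congr1 (fun z => z^-1%g))]|[s Ss /(congr1 (fun z => z^-1%g))]].
    by rewrite invgK -lampV => <-.
  rewrite invgK -shiftV => <-; split=> [|x]; last by rewrite eqxx.
  exact/word_ballV/word_ball_gen.
split; first by rewrite wreathM2; exact: word_ballM.
(* Either the first letter lights the lamp at [x], and then [x] has length 0, or the lamp is one of
   the remaining word translated by [t.2]. *)
move=> x; rewrite wreathM1; have [->|/t1 tx _] := eqVneq (t.1 x) 1%g.
  by rewrite mul1g => /IH1 /(word_ballM t2); rewrite mulKVg.
exact: word_ball_mono tx.
Qed.

End WreathGenerators.
Arguments wreath_gens D {G} S _.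

(** * Upper bound: local embeddings of wreath products *)

Section WreathUpper.
Variables (D : finGroupType) (G Q : groupType) (S : set G) (n : nat) (phi : G -> Q).
Hypothesis emb : local_embedding (word_ball S n.*2) phi.

(** Push-forward of a configuration along [phi], extended by 1 outside the image of the ball. Under
    [emb] the preimage of [q] in the ball is unique, so the choice made by [xget] does not
    matter. *)
Definition push (f : G -> D) (q : Q) : D :=
  let x := xget 1%g [set x | word_ball S n x /\ phi x = q]%classic in
  if `[< word_ball S n x /\ phi x = q >] then f x else 1%g.

Let leBB g : word_ball S n g -> word_ball S n.*2 g.
Proof. by apply: word_ball_mono; rewrite -addnn leq_addr. Qed.

Let BBM g h : word_ball S n g -> word_ball S n h -> word_ball S n.*2 (g * h)%g.
Proof. by rewrite -addnn; exact: word_ballM. Qed.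

Lemma push_image f x : word_ball S n x -> push f (phi x) = f x.
Proof.
move=> Bx; rewrite /push; case: xgetP => [y _ [By yx]|/(_ x)[]//].
by rewrite (asboolT (conj By yx)); congr f; apply: emb.1 => //; exact: leBB.
Qed.

Lemma push_out f q : (forall x, word_ball S n x -> phi x <> q) -> push f q = 1%g.
Proof. by move=> h; rewrite /push; case: asboolP => // -[/h]. Qed.

Let supp_out (f : G -> D) x : (forall y, f y != 1%g -> word_ball S n y) ->
  ~ word_ball S n x -> f x = 1%g.
Proof. by move=> fS nB; apply/eqP/negPn/negP => /fS. Qed.

(** Injectivity on radius 2n keeps the points between radius n and 2n from colliding with the images
    of the smaller ball. Translating a point of the ball by another one leads to such points. *)
Lemma push_image2 f x : word_ball S n.*2 x ->
  (forall y, f y != 1%g -> word_ball S n y) -> push f (phi x) = f x.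
Proof.
move=> Bx fS; have [Bx'|nBx] := pselect (word_ball S n x); first exact: push_image.
rewrite (supp_out fS nBx); apply: push_out => y By yx; apply: nBx.
by rewrite -(emb.1 y x) //; exact: leBB.
Qed.

Lemma local_embedding_wreath :
  local_embedding (word_ball (wreath_gens D S) n)
    (fun u => (push u.1, phi u.2) : wreath D Q).
Proof.
have phi1 : phi 1%g = 1%g.
  apply: (@mulgI _ (phi 1%g)).
  by rewrite mulg1 -emb.2 ?mulg1 //; exact: word_ball1.
have phiM g h : word_ball S n g -> word_ball S n h ->
    phi (g * h)%g = (phi g * phi h)%g.
  by move=> Bg Bh; apply: emb.2; [exact: leBB|exact: leBB|exact: BBM].
have phiV g : word_ball S n g -> phi g^-1%g = (phi g)^-1%g.
  move=> Bg; apply: (@mulgI _ (phi g)).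
  by rewrite mulgV -phiM ?mulgV //; exact: word_ballV.
split=> [[f g] [f' g'] /wreath_ball[/= Bg Bf] /wreath_ball[/= Bg' Bf'] [ff' gg']|].
  congr (_, _); last by apply: emb.1 => //; exact: leBB.
  apply/funext => x; have [Bx|nBx] := pselect (word_ball S n x).
    by rewrite -(push_image f Bx) -(push_image f' Bx) ff'.
  by rewrite (supp_out Bf nBx) (supp_out Bf' nBx).
move=> u v /wreath_ball[Bu2 Bu1] /wreath_ball[Bv2 Bv1] /wreath_ball[_ Buv1].
congr (_, _); last by rewrite /= phiM.
apply/funext => q /=.
have [[x Bx <-]|nq] := pselect (exists2 x, word_ball S n x & phi x = q).
  rewrite !push_image // -phiV // -phiM //; last exact: word_ballV.
  by rewrite push_image2 // ; apply: BBM => //; exact: word_ballV.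
have nq' x : word_ball S n x -> phi x <> q by move=> Bx xq; apply: nq; exists x.
rewrite !(push_out _ nq') mul1g.
(* Off the image of the ball the left side is 1. A lamp of [v] at [y] would make the right side
   nontrivial, but it would also be lit in [u * v] at [u.2 * y], outside the ball, against
   [Buv1]. *)
have [[y By yq]|ny] := pselect (exists2 y, word_ball S n y & phi y = (phi u.2)^-1 * q)%g; last first.
  by rewrite push_out // => x Bx xq; apply: ny; exists x.
rewrite -yq push_image //; apply/esym/eqP/negPn/negP => vy.
have qE : phi (u.2 * y)%g = q by rewrite phiM // yq mulKVg.
have nB : ~ word_ball S n (u.2 * y)%g by move=> /nq'.
apply: (nB); apply: Buv1; rewrite wreathM1 mulKg.
by rewrite (supp_out Bu1 nB) mul1g.
Qed.

End WreathUpper.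

(** * Lower bound: commuting copies of a centerless group *)

Definition centerless (D : groupType) : Prop :=
  forall a : D, (forall e : D, a * e = e * a)%g -> a = 1%g.

(** If [a] moves [x], it does not commute with the transposition of [a x] and a third point [z]. *)
Lemma centerless_S3 : centerless 'S_3.
Proof.
move=> a aC; apply/permP => x; rewrite perm1; apply/eqP/negPn/negP => ax.
have [z] : exists z, z \notin [set x; a x].
  apply/existsP; rewrite -negb_forall; apply/negP => /forallP all_in.
  have : (#|[set: 'I_3]| <= #|[set x; a x]|)%N.
    by apply: subset_leq_card; apply/fintype.subsetP => z _; exact: all_in.
  by rewrite cardsT card_ord cards2; case: (x != a x).
rewrite !inE negb_or => /andP[zx zax].
have /permP/(_ x) := aC (tperm (a x) z).
by rewrite !permM (tpermD ax zx) tpermL => /eqP; rewrite (negbTE zax).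
Qed.

(** The map sending a family [c] to the product of the [f i (c i)] is injective: when two products
    agree, the quotient of their coordinates at [i] is central in [D], hence trivial. *)
Lemma card_commuting_centerless (I : finType) (D Q : finGroupType) (f : I -> D -> Q) :
  centerless D ->
  (forall i d e, f i (d * e)%g = (f i d * f i e)%g) ->
  (forall i, injective (f i)) ->
  (forall i j d e, i != j -> (f i d * f j e = f j e * f i d)%g) ->
  (#|D| ^ #|I| <= #|Q|)%N.
Proof.
move=> Dc fM finj fC; rewrite -card_ffun.
have key (s : seq I) : uniq s -> forall c c' : I -> D,
    (\prod_(i <- s) f i (c i) = \prod_(i <- s) f i (c' i))%g ->
    forall i, i \in s -> c i = c' i.
  elim: s => //= i s IH /andP[ni us] c c'; rewrite !big_cons.
  have comm (b : I -> D) e : (f i e * \prod_(j <- s) f j (b j) =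
      \prod_(j <- s) f j (b j) * f i e)%g.
    elim: s ni {IH us} => [|j s IHs]; first by rewrite !big_nil mulg1 mul1g.
    rewrite inE negb_or => /andP[ij /IHs cs].
    by rewrite !big_cons mulgA fC // -mulgA cs mulgA.
  move=> eqp.
  have ci : c i = c' i.
    apply: (@mulgI _ (c' i)^-1%g); rewrite mulVg; apply: Dc => e.
    apply: (finj i); rewrite !fM.
    (* The discrepancy at [i] is a product of elements of the other copies, so by [comm] it commutes
       with the whole copy at [i]. *)
    have : (f i (c' i)^-1 * f i (c i) =
        \prod_(j <- s) f j (c' j) * (\prod_(j <- s) f j (c j))^-1)%g.
      apply: (@mulIg _ (\prod_(j <- s) f j (c j))%g); rewrite mulgKV -mulgA eqp mulgA -fM mulVg.
      have f1 : f i 1%g = 1%g by apply: (@mulgI _ (f i 1%g)); rewrite -fM !mulg1.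
      by rewrite f1 mul1g.
    move=> ->; rewrite mulgA comm -!mulgA; congr (_ * _)%g.
    apply: (@mulgI _ (\prod_(j <- s) f j (c j))%g); rewrite mulKVg mulgA -comm.
    by rewrite mulgK.
  move=> j; rewrite inE => /orP[/eqP ->//|]; apply: IH => //.
  by move: eqp; rewrite ci => /mulgI.
pose F (c : {ffun I -> D}) := (\prod_(i <- enum I) f i (c i))%g.
apply: (@leq_card _ _ F) => c c' /key eqcc'.
by apply/ffunP => i; apply: eqcc'; rewrite ?enum_uniq ?mem_enum.
Qed.

(** Lamps over the ball of radius m have length at most 2m + 1. The radius is doubled so that
    products of two lamps are in the domain, which is all that multiplicativity and commutation of
    the copies require. *)
Lemma card_local_embedding_wreath (D Q : finGroupType) (G : groupType) (S : set G)
    (I : finType) (m : nat) (f : I -> G) (psi : wreath D G -> Q) :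
  centerless D -> injective f -> (forall i, word_ball S m (f i)) ->
  local_embedding (word_ball (wreath_gens D S) (m.*2.+1).*2) psi ->
  (#|D| ^ #|I| <= #|Q|)%N.
Proof.
move=> Dc finj Bf [inj mor].
have lampB i d : word_ball (wreath_gens D S) (m.*2.+1) (lamp (f i) d) by exact: lamp_ball.
have lampB2 i d : word_ball (wreath_gens D S) (m.*2.+1).*2 (lamp (f i) d).
  by apply: word_ball_mono (lampB i d); rewrite -[(_.+1).*2]addnn leq_addr.
have lampBB i j d e : word_ball (wreath_gens D S) (m.*2.+1).*2
    (lamp (f i) d * lamp (f j) e)%g.
  by rewrite -[(_.+1).*2]addnn; exact: word_ballM.
apply: (card_commuting_centerless (f := fun i d => psi (lamp (f i) d))) => //.
- by move=> i d e; rewrite lampM mor.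
- by move=> i d e /inj-/(_ (lampB2 _ _) (lampB2 _ _))/lamp_inj.
- move=> i j d e ij; rewrite -!mor // lamp_commute //.
  by rewrite (inj_eq finj).
Qed.

(** * The lattice [Z^k] *)

Section Lattice.
Variable k : nat.

Definition lattice : groupType := mulg_of 'rV[int]_k.

(** With all 0/1 vectors as generators, the ball of radius n contains the full box of side n, so no
    constant depends on [k]. *)
Definition cube_gens : set lattice :=
  range (fun b : {ffun 'I_k -> bool} => \row_i (b i : nat)%:Z).

Lemma cube_gens_finite : finite_set cube_gens.
Proof. exact/finite_image/finite_finset. Qed.

Lemma lattice_mulE (u v : lattice) i : (u * v)%g 0 i = u 0 i + v 0 i.
Proof. exact: mxE. Qed.

Lemma lattice_invE (u : lattice) i : (u^-1)%g 0 i = - u 0 i.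
Proof. exact: mxE. Qed.

Lemma lattice_oneE i : (1%g : lattice) 0 i = 0.
Proof. exact: mxE. Qed.

Lemma lattice_prodE (I : Type) (r : seq I) (F : I -> lattice) i :
  (\prod_(j <- r) F j)%g 0 i = \sum_(j <- r) F j 0 i.
Proof.
by apply: (big_morph (fun u : lattice => u 0 i)) => [u v|];
  rewrite ?lattice_mulE ?lattice_oneE.
Qed.

Lemma lattice_ball_coord n (v : lattice) i :
  word_ball cube_gens n v -> `|v 0 i| <= n%:Z.
Proof.
move=> [w [sw Sw ->]]; rewrite lattice_prodE.
have S1 x : x \in w -> `|(x : lattice) 0 i| <= 1.
  have bool1 (u : lattice) : cube_gens u -> `|u 0 i| <= 1.
    by move=> [b _ <-]; rewrite mxE; case: (b i).
  by move=> /Sw[/bool1//|/bool1]; rewrite lattice_invE normrN.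
rewrite (le_trans (ler_norm_sum _ _ _)) //.
rewrite (@le_trans _ _ (\sum_(x <- w) 1)) //.
  by rewrite big_seq [leRHS]big_seq ler_sum.
by rewrite big_const_seq count_predT iter_addr_0 natz lez_nat.
Qed.

(** Cut the vector into n layers with 0/1 entries, the layer [j] marking the coordinates larger than
    [j]. *)
Lemma lattice_ball_box n (c : 'I_k -> 'I_n.+1) :
  word_ball cube_gens n (\row_i (c i : nat)%:Z : lattice).
Proof.
have -> : (\row_i (c i : nat)%:Z : lattice) =
    (\prod_(j <- iota 0 n) (\row_i (nat_of_bool (j < c i)%N)%:Z : lattice))%g.
  apply/rowP => i; rewrite lattice_prodE mxE.
  under eq_bigr do rewrite mxE -natz.
  rewrite -natr_sum natz; congr Posz.
  have -> : (\sum_(j <- iota 0 n) (j < c i) = count (fun j => j < c i) (iota 0 n))%N.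
    by elim: iota => [|j s IH]; rewrite ?big_nil ?big_cons //= IH.
  move: (nat_of_ord (c i)) (ltn_ord (c i)) => m; rewrite ltnS => mn.
  rewrite -(subnKC mn) iotaD count_cat add0n.
  have -> : count (fun j => j < m)%N (iota 0 m) = m.
    apply/eqP; rewrite -[X in _ == X](size_iota 0) -all_count.
    by apply/allP => j; rewrite mem_iota.
  suff -> : count (fun j => j < m)%N (iota m (n - m)) = 0%N by rewrite addn0.
  apply/eqP; rewrite -leqn0 leqNgt -has_count -all_predC.
  by apply/allP => j; rewrite mem_iota /= -leqNgt => /andP[].
rewrite -[n in word_ball _ n]muln1; apply: word_ball_prod; last by rewrite size_iota.
move=> j; apply: word_ball_gen; exists [ffun i => (j < c i)%N] => //.
by apply/rowP => i; rewrite !mxE ffunE.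
Qed.

(** Reduction modulo 2n + 2: coordinates in the ball differ by at most 2n, so congruent ones are
    equal. *)
Lemma lattice_local_embedding n :
  exists phi : lattice -> 'rV['I_n.*2.+2]_k,
    local_embedding (word_ball cube_gens n) phi.
Proof.
exists (fun v : lattice => \row_i (v 0 i)%:~R); split=> [u v Bu Bv /rowP eq|u v _ _ _]; last first.
  by apply/rowP => i; rewrite !mxE intrD.
apply/rowP => i; have := eq i; rewrite !mxE => /eqP.
rewrite -subr_eq0 -intrB => /eqP eq0; apply/eqP; rewrite -subr_eq0.
have : (absz (u 0 i - v 0 i)%R <= n.*2)%N.
  rewrite -lez_nat abszE (le_trans (ler_normB _ _)) // -addnn PoszD.
  by rewrite lerD ?lattice_ball_coord.
have small m : (m <= n.*2)%N -> m%:R = 0 :> 'I_n.*2.+2 -> m = 0%N.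
  move=> mn m0; have := @val_Zp_nat n.*2.+2 isT m.
  by rewrite [m%:R]m0 modn_small // ltnS (leq_trans mn).
case: (u 0 i - v 0 i) eq0 => m; first by move=> m0 /small/(_ m0)/= ->.
by rewrite NegzE mulrNz => /eqP; rewrite oppr_eq0 => /eqP m0 /small/(_ m0).
Qed.

Lemma card_lattice_quotient n :
  #|('rV['I_n.+1]_k : finGroupType)| = (n.+1 ^ k)%N.
Proof. by rewrite card_mx card_ord mul1n. Qed.
End Lattice.

(** * Exponentially many elements in lamplighter balls *)

Section LamplighterWords.
Variable D : finGroupType.
Let Z := lattice 1.

Definition unit_step : Z := const_mx 1.

(** Writes the letters of [s] at 0, 1, 2, ... while moving right, two generators per letter. *)
Fixpoint lamp_word (s : seq D) : wreath D Z :=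
  if s is d :: s' then (lamp 1 d * shift D unit_step * lamp_word s')%g else 1%g.

Lemma lamp_word_ball s :
  word_ball (wreath_gens D (@cube_gens 1)) (size s).*2 (lamp_word s).
Proof.
elim: s => [|d s IH] /=; first exact: word_ball0.
rewrite doubleS -addn2 addnC; apply: word_ballM IH.
apply: (@word_ballM _ _ 1 1); apply: word_ball_gen; first by left; exists d.
right; exists unit_step => //; exists [ffun=> true] => //.
by apply/rowP => i; rewrite !mxE ffunE.
Qed.

Lemma lamp_word_cons d s (x : Z) :
  (lamp_word (d :: s)).1 x =
  ((if x == 1%g then d else 1) * (lamp_word s).1 (unit_step^-1 * x))%g.
Proof.
rewrite -[lamp_word (d :: s)]/(lamp 1 d * shift D unit_step * lamp_word s)%g.
by rewrite 2!wreathM1 wreathM2 /= mulg1 mul1g.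
Qed.

Lemma lamp_word_neg s (x : Z) : x 0 0 < 0 -> (lamp_word s).1 x = 1%g.
Proof.
elim: s x => [//|d s IH] x x0; rewrite lamp_word_cons ifF.
  rewrite mul1g IH // lattice_mulE lattice_invE mxE.
  by rewrite addrC subr_lt0 (lt_trans x0).
by apply/eqP => x1; rewrite x1 lattice_oneE ltxx in x0.
Qed.

Lemma lamp_word_inj s t : size s = size t -> lamp_word s = lamp_word t -> s = t.
Proof.
elim: s t => [|d s IH] [|e t]//= [] /IH{}IH eqst.
have de : d = e.
  have /(congr1 (fun u : wreath D Z => u.1 1%g)) := eqst.
  (* The lamp at the origin shows the first letter: the rest of the word starts one step to the
     right and never comes back. *)
  rewrite -!/(lamp_word (_ :: _)) !lamp_word_cons eqxx mulg1.
  rewrite !lamp_word_neg ?mulg1 //; by rewrite lattice_invE mxE.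
by move: eqst; rewrite de => /mulgI/IH ->.
Qed.

End LamplighterWords.

(** * Numerical estimates for the exponential *)

Section Bounds.
Variable R : realType.

Lemma expR1_ge2 : 2 <= expR 1 :> R.
Proof. exact: le_trans (expR_ge1Dx 1). Qed.

(** Invert exp(-1/2) >= 1 - 1/2 and square. *)
Lemma expR1_le4 : expR 1 <= 4 :> R.
Proof.
have h : 2^-1 <= expR (- 2^-1) :> R.
  by apply: le_trans (expR_ge1Dx _); rewrite {2}[1]splitr mul1r addrK.
have h2 : expR 2^-1 <= 2 :> R.
  by move: h; rewrite expRN lef_pV2 ?posrE ?expR_gt0.
have -> : expR 1 = expR 2^-1 * expR 2^-1 :> R.
  by rewrite -expRD; congr expR; rewrite {1}[1]splitr mul1r.
rewrite (_ : 4 = 2 * 2) ?ler_pM ?expR_ge0 //.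
by rewrite -natrM.
Qed.

Lemma expR_natr (n : nat) : expR n%:R = expR 1 ^+ n :> R.
Proof. by rewrite -expRM_natl mulr1. Qed.

Lemma expR_le_exp6 (n : nat) : expR n%:R <= (6 ^ n)%:R :> R.
Proof.
rewrite expR_natr natrX lerXn2r ?nnegrE ?expR_ge0 //.
by rewrite (le_trans expR1_le4) // ler_nat.
Qed.

(** The left side is the order of [S_3] wr [Q] for |Q| = n; it is at most 12^n <= 2^(4n). *)
Lemma exp6_le_expR (n : nat) : (6 ^ n * n)%:R <= expR (4 * n%:R) :> R.
Proof.
apply: (@le_trans _ _ (16 ^ n)%:R).
  rewrite ler_nat; apply: (@leq_trans (6 ^ n * 2 ^ n)).
    by rewrite leq_mul2l (ltnW (ltn_expl _ _)) ?orbT.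
  by rewrite -expnMn; case: n => // n; rewrite leq_exp2r.
rewrite -natrM expR_natr exprM natrX lerXn2r ?nnegrE ?exprn_ge0 ?expR_ge0 //.
by rewrite (_ : 16%:R = 2 ^+ 4) ?lerXn2r ?nnegrE ?expR_ge0 ?expR1_ge2 // -natrX.
Qed.

End Bounds.

(** * The three families of examples *)

Lemma card_S3 : #|('S_3 : finGroupType)| = 6.
Proof. by rewrite card_Sn. Qed.

(** Each wreath product with [S_3] costs one exponential in the order and a factor 2 in the
    radius. *)
Lemma wreath_S3_upper (R : realType) (G : groupType) (S : set G) (n : nat)
    (Q : finGroupType) (phi : G -> Q) :
  local_embedding (word_ball S n.*2) phi ->
  exists (Q' : finGroupType) (psi : wreath 'S_3 G -> Q'),
    local_embedding (word_ball (wreath_gens 'S_3 S) n) psi /\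
    #|Q'|%:R <= expR (4 * #|Q|%:R) :> R.
Proof.
move=> emb; exists (wreath 'S_3 Q), (fun u => (push S n phi u.1, phi u.2)).
split; first exact: local_embedding_wreath.
by rewrite card_wreath card_S3 exp6_le_expR.
Qed.

Lemma lattice_box_inj k n :
  injective (fun c : {ffun 'I_k -> 'I_n.+1} => \row_i (c i : nat)%:Z : lattice k).
Proof.
move=> c c' /rowP eqcc'; apply/ffunP => i; apply: val_inj.
by have := eqcc' i; rewrite !mxE => -[].
Qed.

Section Examples.
Variable R : realType.

Lemma exists_growth_poly k : (0 < k)%N ->
  exists G : groupType, finitely_generated G /\ LEF G /\
    has_LEF_growth G (fun n : nat => (n%:R : R) ^+ k).
Proof.
(* The modulus satisfies 2n + 2 <= 4n; the ball of radius n itself contains (n + 1)^k points. *)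
move=> k0; apply: (@exists_group_of_growth _ _ (lattice k) (@cube_gens k) 4 1).
- exact: cube_gens_finite.
- by move=> m n mn; rewrite lerXn2r ?nnegrE ?ler0n ?ler_nat.
- move=> n n0; have [phi emb] := lattice_local_embedding k n.
  exists 'rV['I_n.*2.+2]_k, phi; split=> //.
  rewrite card_lattice_quotient -natrX ler_nat leq_exp2r //; lia.
- move=> n Q pi _; rewrite mul1n => -[inj _].
  rewrite -natrX ler_nat (@leq_trans (n.+1 ^ k)%N) ?leq_exp2r //.
  rewrite -[X in (X ^ _)%N]card_ord -[X in (_ ^ X)%N]card_ord -card_ffun.
  apply: (leq_card (fun c : {ffun 'I_k -> 'I_n.+1} => pi (\row_i (c i : nat)%:Z : lattice k))).
  by move=> c c' /inj eqcc'; apply: lattice_box_inj; apply: eqcc'; exact: lattice_ball_box.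
Qed.

Lemma exists_growth_exp k : (0 < k)%N ->
  exists G : groupType, finitely_generated G /\ LEF G /\
    has_LEF_growth G (fun n : nat => expR ((n%:R : R) ^+ k)).
Proof.
(* At radius 2n the modulus is 4n + 2 <= 6n, and 4 (6n)^k <= (24n)^k. For the lower bound, lamps
   over the ball of radius n need radius 2(2n + 1) <= 6n. *)
move=> k0; apply: (@exists_group_of_growth _ _ (wreath 'S_3 (lattice k))
  (wreath_gens 'S_3 (@cube_gens k)) 24 6).
- exact/wreath_gens_finite/cube_gens_finite.
- by move=> m n mn; rewrite ler_expR lerXn2r ?nnegrE ?ler0n ?ler_nat.
- move=> n n0; have [phi /(wreath_S3_upper R)[Q [psi [emb le]]]] :=
    lattice_local_embedding k n.*2.
  exists Q, psi; split=> //; apply: le_trans le _; rewrite ler_expR.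
  rewrite card_lattice_quotient -natrM -natrX ler_nat.
  apply: (@leq_trans (4 ^ k * (6 * n) ^ k)).
    rewrite leq_mul //; first by rewrite -[X in (X <= _)%N]expn1 leq_exp2l.
    rewrite leq_exp2r //; lia.
  by rewrite -expnMn mulnA.
- move=> n Q psi n0 emb; rewrite -natrX.
  apply: le_trans (expR_le_exp6 _ _) _; rewrite ler_nat.
  apply: (@leq_trans (6 ^ (n.+1 ^ k))); first by rewrite leq_exp2l // leq_exp2r.
  have := @card_local_embedding_wreath 'S_3 Q (lattice k) (@cube_gens k) _ n _ psi
    centerless_S3 (@lattice_box_inj k n).
  rewrite card_S3 card_ffun !card_ord; apply; first by move=> c; exact: lattice_ball_box.
  apply: local_embedding_sub emb => g; apply: word_ball_mono; lia.
Qed.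

Lemma exists_growth_expexp :
  exists G : groupType, finitely_generated G /\ LEF G /\
    has_LEF_growth G (fun n : nat => expR (expR (n%:R : R))).
Proof.
(* At radius 4n the modulus is 8n + 2, so the inner quotient has order at most exp(40n), and 4
   exp(40n) <= exp(42n). The words used below lie in the inner ball of radius 2n, and 2(4n + 1) <=
   10n. *)
apply: (@exists_group_of_growth _ _ (wreath 'S_3 (wreath 'S_3 (lattice 1)))
  (wreath_gens 'S_3 (wreath_gens 'S_3 (@cube_gens 1))) 42 10).
- exact/wreath_gens_finite/wreath_gens_finite/cube_gens_finite.
- by move=> m n mn; rewrite !ler_expR ler_nat.
- move=> n n0; have [phi /(wreath_S3_upper R)[Q [psi [emb le]]]] :=
    lattice_local_embedding 1 n.*2.*2.
  have [Q' [psi' [emb' le']]] := wreath_S3_upper R emb.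
  exists Q', psi'; split=> //; apply: le_trans le' _; rewrite ler_expR.
  rewrite (_ : 42 = 2 + 40)%N // mulnDl natrD expRD ler_pM ?ler0n //.
    apply: (@le_trans _ _ (expR 2)); last by rewrite ler_expR ler_nat leq_pmulr.
    rewrite expR_natr (_ : 4 = 2 ^+ 2); last by rewrite -natrX.
    by rewrite lerXn2r ?nnegrE ?expR_ge0 ?expR1_ge2.
  apply: le_trans le _; rewrite ler_expR card_lattice_quotient -natrM ler_nat expn1; lia.
- move=> n Q psi n0 emb.
  apply: (@le_trans _ _ (expR (6 ^ n)%:R)); first by rewrite ler_expR expR_le_exp6.
  apply: le_trans (expR_le_exp6 _ _) _; rewrite ler_nat.
  (* The points carrying the commuting copies are the 6^n lamplighter words of n letters. *)
  have inj : injective (fun s : n.-tuple 'S_3 => lamp_word s).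
    by move=> s t /lamp_word_inj eqst; apply: val_inj; apply: eqst; rewrite !size_tuple.
  have := @card_local_embedding_wreath 'S_3 Q _ (wreath_gens 'S_3 (@cube_gens 1)) _
    n.*2 _ psi centerless_S3 inj.
  rewrite card_tuple card_S3; apply.
    by move=> s; have := lamp_word_ball s; rewrite size_tuple.
  apply: local_embedding_sub emb => g; apply: word_ball_mono; lia.
Qed.

End Examples.

Theorem theorem1p8 (R : realType) :
  (exists G : groupType, finitely_generated G /\ LEF G /\
     has_LEF_growth G (fun n : nat => expR (expR (n%:R : R))))
  /\ (forall k : nat, (0 < k)%N ->
       exists G : groupType, finitely_generated G /\ LEF G /\
         has_LEF_growth G (fun n : nat => expR ((n%:R : R) ^+ k)))
  /\ (forall k : nat, (0 < k)%N ->
       exists G : groupType, finitely_generated G /\ LEF G /\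
         has_LEF_growth G (fun n : nat => (n%:R : R) ^+ k)).
Proof.
split; first exact: exists_growth_expexp.
by split=> k; [exact: exists_growth_exp|exact: exists_growth_poly].
Qed.
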